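(* Let $k\ge 0$ and $m>2k$ be integers and let $a_0,a_1,\dots,a_k$ be real numbers with $a_0>a_1>\cdots>a_k>0$. Then all the roots in $\mathbf{C}$ of the polynomial $$f(T)=a_0+a_1T+\cdots+a_kT^k+a_kT^{m-k}+a_{k-1}T^{m-k+1}+\cdots+a_0T^m$$ lie on the unit circle $|T|=1$. *)

(* Defs.v *)
From mathcomp Require Import all_boot all_order all_algebra.
From mathcomp Require Import reals complex.
Set Implicit Arguments.
Unset Strict Implicit.
Unset Printing Implicit Defensive.
Import GRing.Theory.
Local Open Scope ring_scope.

(* a_0 + a_1 T + ... + a_k T^k + a_k T^(m-k) + ... + a_0 T^m; the natural-number
   subtraction m - i is exact as soon as k <= m. *)
Definition self_reciprocal_poly (R : nzRingType) (k m : nat) (a : 'I_k.+1 -> R)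
    : {poly R} :=
  \sum_(i < k.+1) a i *: 'X^i + \sum_(i < k.+1) a i *: 'X^(m - i).

(* Main.v *)
Require Import Defs.
From mathcomp Require Import all_boot all_order all_algebra.
From mathcomp Require Import reals complex.
From mathcomp Require Import ring.
Import Order.TTheory GRing.Theory Num.Theory.
Local Open Scope ring_scope.
Local Open Scope complex_scope.

(** Write [p] for the polynomial with coefficients [a_0, ..., a_k], so that the
    polynomial of the theorem takes the value [p(z) + z^m p(1/z)] at [z <> 0].
    Replacing [z] by [1/z] multiplies this value by [z^(-m)], so the zeros are
    stable under inversion; the value at [0] being [a_0 > 0], it is enough to
    exclude the zeros with [0 < |z| < 1].

    In this punctured disc the first term dominates. By the Enestrom-Kakeya theorem
    ([horner_neq0_nonincreasing_coefs]) the monotonicity of the [a_i] forces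
    every root [w] of [p] to satisfy [|w| >= 1]. Factoring [p] over these roots,
    [z^k p(1/z)] becomes [a_k] times a product of factors [1 - z w], each of norm
    at most [|z^* - w|]; hence [|z^k p(1/z)| <= |p(z^* )| = |p(z)|], the last
    equality because the coefficients are real. This is the Blaschke-product
    bound, obtained from the factorization instead of the maximum principle
    ([norm_horner_reversed_le]). Since [m > k], a zero in the punctured disc
    would give [0 < |p(z)| = |z|^(m - k) |z^k p(1/z)| <= |z|^(m - k) |p(z)|],
    and the right-hand side is smaller than [|p(z)|]. *)

(** Enestrom-Kakeya. The constant coefficient of [(1 - 'X) * p] is [p`_0], its
    other coefficients are nonpositive, and all of them sum to [0]: the
    nonconstant part is thus at most [`|z| * p`_0] in norm. Coefficients beyond
    the size are [0], so the hypothesis also makes all of them nonnegative. *)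
Lemma horner_neq0_nonincreasing_coefs (C : numDomainType) (p : {poly C}) (z : C) :
  0 < p`_0 -> (forall i, p`_i.+1 <= p`_i) -> `|z| < 1 -> p.[z] != 0.
Proof.
move=> p0_gt0 p_noninc z_lt1.
have q_horner x : (1 - x) * p.[x] =
    p`_0 - \sum_(i < size p) (p`_i - p`_i.+1) * x ^+ i.+1.
  have -> : (1 - x) * p.[x] = ((1 - 'X) * p).[x] by rewrite !hornerE.
  rewrite (@horner_coef_wide _ (size p).+1); last first.
    rewrite (leq_trans (size_polyMleq _ _)) // -opprB size_polyN.
    by rewrite -[1]/(1%:P) size_XsubC.
  rewrite big_ord_recl expr0 mulr1 mulrBl mul1r coefB coefXM eqxx subr0.
  congr (_ + _); rewrite -sumrN; apply: eq_bigr => i _.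
  by rewrite coefB coefXM /= -mulNr opprB.
have sum_diff : \sum_(i < size p) (p`_i - p`_i.+1) = p`_0.
  have := q_horner 1; rewrite subrr mul0r => /esym/eqP.
  rewrite subr_eq0 => /eqP ->; apply: eq_bigr => i _.
  by rewrite expr1n mulr1.
apply/negP => /eqP pz0; have := q_horner z.
rewrite pz0 mulr0 => /esym/eqP; rewrite subr_eq0 => /eqP p0E.
have : p`_0 <= `|z| * p`_0.
  rewrite -{1}(gtr0_norm p0_gt0) {1}p0E -sum_diff mulr_sumr.
  apply: (le_trans (ler_norm_sum _ _ _)); apply: ler_sum => i _.
  have d_ge0 : 0 <= p`_i - p`_i.+1 by rewrite subr_ge0.
  rewrite normrM normrX (ger0_norm d_ge0) mulrC ler_wpM2r //.
  by rewrite exprS ler_piMr // exprn_ile1 // ltW.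
by move=> /le_lt_trans le_lt; have := le_lt p`_0; rewrite ltxx gtr_pMl // => /(_ z_lt1).
Qed.

(** The difference of the squared norms is [(1 - `|z|^2) * (`|w|^2 - 1)]. *)
Lemma norm_1Mz_le_conj_sub (C : numClosedFieldType) (z w : C) :
  `|z| <= 1 -> 1 <= `|w| -> `|1 - z * w| <= `|Num.conj z - w|.
Proof.
move=> z_le1 w_ge1; rewrite -(@ler_pXn2r _ 2) ?nnegrE // -subr_ge0.
have -> : `|Num.conj z - w| ^+ 2 - `|1 - z * w| ^+ 2 =
    (1 - `|z| ^+ 2) * (`|w| ^+ 2 - 1).
  by rewrite !normCK !rmorphB rmorphM rmorph1 /= conjCK; ring.
by rewrite mulr_ge0 // subr_ge0 ?exprn_ile1 ?exprn_ege1.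
Qed.

(** The left-hand side is the value at [z] of the polynomial with the
    coefficients of [p] in reverse order, which is [lead_coef p] times the
    product of the [1 - z * w] over the roots [w] of [p]. *)
Lemma norm_horner_reversed_le (C : numClosedFieldType) (p : {poly C}) (z : C) :
  (forall w, `|w| < 1 -> p.[w] != 0) -> z != 0 -> `|z| <= 1 ->
  `|z ^+ (size p).-1 * p.[z^-1]| <= `|p.[Num.conj z]|.
Proof.
move=> p_neq0 z_neq0 z_le1.
have [rs pE] := closed_field_poly_normal p.
have c_neq0 : lead_coef p != 0.
  by rewrite lead_coef_eq0; apply: contraNneq (p_neq0 0 _) => [->|];
    rewrite ?horner0 ?normr0.
have rs_ge1 w : w \in rs -> 1 <= `|w|.
  move=> w_rs; rewrite real_leNgt ?realE ?normr_ge0 ?ler01 //.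
  apply/negP => /p_neq0/negP; apply.
  by rewrite -/(root p w) pE rootZ // root_prod_XsubC.
have size_rs : (size p).-1 = size rs.
  by rewrite {1}pE size_scale // size_prod_XsubC.
have horner_p x : p.[x] = lead_coef p * \prod_(w <- rs) (x - w).
  rewrite {1}pE hornerZ horner_prod; congr (_ * _).
  by apply: eq_bigr => w _; rewrite !hornerE.
have -> : z ^+ (size p).-1 * p.[z^-1] = lead_coef p * \prod_(w <- rs) (1 - z * w).
  rewrite size_rs horner_p mulrCA; congr (_ * _).
  rewrite -sum1_size -prodrXr -big_split /=; apply: eq_bigr => w _.
  by rewrite expr1 mulrBr divff.
rewrite horner_p !normrM ler_wpM2l // !normr_prod !big_seq.
apply: ler_prod => w w_rs; rewrite normr_ge0 /=.
exact: norm_1Mz_le_conj_sub z_le1 (rs_ge1 w w_rs).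
Qed.

(** In the open unit disc [`|p.[z]|] exceeds the norm of the second term, because
    [m] is larger than the degree of [p]. At [z = 0] the second term is [0], and
    the statement says that the constant coefficient of [p] is nonzero. *)
Lemma horner_add_reversed_neq0 (C : numClosedFieldType) (p : {poly C}) (m : nat)
    (z : C) :
  (forall w, `|w| < 1 -> p.[w] != 0) -> p \is a polyOver Num.real ->
  (size p <= m)%N -> `|z| < 1 -> p.[z] + z ^+ m * p.[z^-1] != 0.
Proof.
move=> p_neq0 p_real le_p_m z_lt1.
have horner_conj : p.[Num.conj z] = Num.conj p.[z].
  rewrite -horner_map /=; congr (_.[_]); apply/polyP => i.
  by rewrite coef_map /=; apply/esym/CrealP/(polyOverP p_real).
have size_p_gt0 : (0 < size p)%N.
  rewrite size_poly_gt0; apply: contraNneq (p_neq0 0 _) => [->|];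
    by rewrite ?horner0 ?normr0.
have [->|z_neq0] := eqVneq z 0.
  by rewrite expr0n eqn0Ngt (leq_trans size_p_gt0) // mul0r addr0 p_neq0 ?normr0.
apply/negP; rewrite addr_eq0 => /eqP pzE.
have pz_gt0 : 0 < `|p.[z]| by rewrite normr_gt0 p_neq0.
have: `|p.[z]| < `|p.[z]|.
  rewrite {1}pzE normrN -(subnK (leq_trans (leq_pred _) le_p_m)) exprD -mulrA.
  rewrite normrM normrX.
  have := norm_horner_reversed_le _ _ _ p_neq0 z_neq0 (ltW z_lt1).
  rewrite horner_conj norm_conjC => /(ler_wpM2l _) le_p.
  apply: (le_lt_trans (le_p _ _)); first exact: exprn_ge0.
  rewrite gtr_pMl // exprn_ilt1 // -lt0n subn_gt0.
  by rewrite (leq_trans _ le_p_m) // prednK.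
by rewrite ltxx.
Qed.

Theorem theorem1p7 (R : realType) (k m : nat) (a : 'I_k.+1 -> R)
    (hm : (2 * k < m)%N)
    (ha : forall i j : 'I_k.+1, (i < j)%N -> a j < a i)
    (hk : 0 < a ord_max) :
  forall z : R[i],
    root (map_poly (real_complex R) (self_reciprocal_poly m a)) z -> `|z| = 1.
Proof.
have lt_k_m : (k < m)%N by apply: leq_ltn_trans hm; rewrite leq_pmull.
pose q := \poly_(i < k.+1) a (inord i).
pose p := map_poly (real_complex R) q.
have q_noninc i : q`_i.+1 <= q`_i.
  rewrite !coef_poly ltnS; case: (ltnP i k) => [lt_ik|le_ki].
    by rewrite ltnS (ltnW lt_ik); apply/ltW/ha; rewrite !inordK // ltnS ltnW.
  case: ifP => // lt_ik; have -> : inord i = ord_max :> 'I_k.+1; last exact: ltW.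
  by apply/val_inj/eqP; rewrite /= inordK // eqn_leq le_ki -ltnS lt_ik.
have q0_gt0 : 0 < q`_0.
  rewrite coef_poly /=; case: (posnP k) => [k0|k_gt0].
    by congr (0 < a _) : hk; apply/val_inj; rewrite /= inordK.
  by apply/(lt_trans hk)/ha; rewrite /= inordK.
have p_neq0 w : `|w| < 1 -> p.[w] != 0.
  apply: horner_neq0_nonincreasing_coefs => [|i]; rewrite !coef_map.
    by rewrite ltcR.
  by rewrite lecR.
have p_real : p \is a polyOver Num.real.
  by apply/polyOverP => i; rewrite coef_map /= complex_real.
have size_p : (size p <= m)%N.
  by rewrite size_map_poly (leq_trans (size_poly _ _)).
have pE x : p.[x] = \sum_(i < k.+1) (a i)%:C * x ^+ i.
  rewrite (@horner_coef_wide _ k.+1) ?size_map_poly ?size_poly //.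
  apply: eq_bigr => i _; rewrite coef_map coef_poly ltn_ord.
  by rewrite inord_val.
pose f := map_poly (real_complex R) (self_reciprocal_poly m a).
(* This also holds at [x = 0], with [0^-1 = 0], because [i < m] for all [i]. *)
have fE x : f.[x] = p.[x] + x ^+ m * p.[x^-1].
  rewrite /f /self_reciprocal_poly rmorphD !rmorph_sum hornerD.
  rewrite !horner_sum !pE mulr_sumr; congr (_ + _); apply: eq_bigr => i _.
    by rewrite /= map_polyZ map_polyXn hornerZ hornerXn.
  rewrite /= map_polyZ map_polyXn hornerZ hornerXn mulrCA; congr (_ * _).
  have lt_im : (i < m)%N by rewrite (leq_ltn_trans _ lt_k_m) // -ltnS.
  by rewrite exprVn expfB.
have f_disc_neq0 x : `|x| < 1 -> f.[x] != 0.
  by move=> x_lt1; rewrite fE horner_add_reversed_neq0.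
have f_inv x : x != 0 -> f.[x^-1] = x^-1 ^+ m * f.[x].
  move=> x_neq0; rewrite !fE invrK mulrDr addrC mulrA -exprMn.
  by rewrite mulVf // expr1n mul1r.
move=> z /rootP fz0; rewrite -/f in fz0.
case: (real_ltgtP (normr_real z) (real1 _)) => // [z_lt1|z_gt1].
  by have := f_disc_neq0 z z_lt1; rewrite fz0 eqxx.
have z_neq0 : z != 0 by rewrite -normr_gt0 (lt_trans ltr01).
have := f_disc_neq0 z^-1; rewrite normfV invf_lt1 ?normr_gt0 //.
by rewrite f_inv // fz0 mulr0 eqxx => /(_ z_gt1).
Qed.
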